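(* Let $G^*=G*_{t,\phi:A\to B}$ be an HNN extension of a finitely generated group $G$ such that the associated subgroups $A,B$ are also finitely generated. Assume that $G$ has decidable word problem and that the membership problems for $A$ in $G$ and for $B$ in $G$ are decidable. Let $M$ be a submonoid of $G^*$ such that the following conditions hold: (i) $A\cup B\subseteq M$; (ii) $M\cap G$ is a finitely generated monoid, and $M$ is generated, as a monoid, by $(M\cap G)\cup\{t,t^{-1}\}$; (iii) the membership problem for $M\cap G$ in $G$ is decidable. Then the membership problem for $M$ in $G^*$ is decidable.
   Context: For a group $G$ with isomorphic subgroups $A,B\le G$ and an isomorphism $\phi:A\to B$, $G^*=G*_{t,\phi:A\to B}$ denotes the HNN extension of $G$ with stable letter $t$ and associated subgroups $A,B$, i.e. the group obtained from $G$ by adding a new generator $t$ and the relations $t^{-1}at=a\phi$ for all $a\in A$. The group $G$ is regarded as a subgroup of $G^*$. $G$ comes with a fixed finite generating set $X$, and $G^*$ with the generating set $X\cup\{t\}$; $\phi$ is given by fixed words over $X$ for a finite set of generators of $A$ and for their images. For a set $\Omega$ write $\overline{\Omega}=\Omega\cup\Omega^{-1}$. For a group $K$ with finite generating set $\Omega$ and canonical homomorphism $\pi:\overline{\Omega}^*\to K$ and a finitely generated submonoid or subgroup $N$ of $K$, the membership problem for $N$ in $K$ is decidable if there is an algorithm which, given any word $w\in\overline{\Omega}^*$, decides whether $w\pi\in N$. *)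

(* Defs.v *)
From HB Require Import structures.
From mathcomp Require Import all_boot.
From mathcomp Require Import boolp classical_sets functions cardinality.

Set Implicit Arguments.
Unset Strict Implicit.
Unset Printing Implicit Defensive.

Local Open Scope group_scope.
Local Open Scope classical_set_scope.
Local Open Scope quotient_scope.

(* Kleene's total (general) recursive functions.  Minimization is only
   allowed on regular functions, i.e., when a zero exists for every v; hence
   every member is total and no partial functions are needed. *)
Inductive recursive : forall k : nat, (k.-tuple nat -> nat) -> Prop :=
| recursive_zero : recursive (fun _ : 0.-tuple nat => 0)
| recursive_succ : recursive (fun v : 1.-tuple nat => (thead v).+1)
| recursive_proj k (i : 'I_k) : recursive (fun v : k.-tuple nat => tnth v i)
| recursive_comp k m (f : m.-tuple nat -> nat) (g : 'I_m -> k.-tuple nat -> nat) :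
    recursive f -> (forall i, recursive (g i)) ->
    recursive (fun v : k.-tuple nat => f [tuple g i v | i < m])
| recursive_prim k (f : k.-tuple nat -> nat) (g : k.+2.-tuple nat -> nat) :
    recursive f -> recursive g ->
    recursive (fun v : k.+1.-tuple nat =>
      nat_rect (fun _ => nat) (f [tuple of behead v])
        (fun m r => g [tuple of m :: r :: behead v]) (thead v))
| recursive_min k (f : k.+1.-tuple nat -> nat)
    (f0 : forall v : k.-tuple nat, exists m, f [tuple of m :: v] == 0) :
    recursive f -> recursive (fun v : k.-tuple nat => ex_minn (f0 v)).

(* Words over an alphabet of n generators and their formal inverses:
   (i, false) is the i-th generator, (i, true) its formal inverse. *)
Definition word (n : nat) := seq ('I_n * bool).

(* The Goedel number of a word; CodeSeq.code is a bijection seq nat -> nat. *)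
Definition word_code (n : nat) (w : word n) : nat :=
  CodeSeq.code [seq (val l.1).*2 + nat_of_bool l.2 | l <- w]%N.

Section Groups.
Variable K : groupType.

Definition is_submonoid (N : set K) : Prop := monoid_closed [in N].
Definition is_subgroup (N : set K) : Prop := group_closed [in N].

Definition submonoid_gen (S : set K) : set K := smallest is_submonoid S.
Definition subgroup_gen (S : set K) : set K := smallest is_subgroup S.

Definition fg_submonoid (N : set K) : Prop :=
  exists2 S : set K, finite_set S & N = submonoid_gen S.
Definition fg_subgroup (N : set K) : Prop :=
  exists2 S : set K, finite_set S & N = subgroup_gen S.

Definition word_value (n : nat) (x : 'I_n -> K) (w : word n) : K :=
  \prod_(l <- w) (if l.2 then (x l.1)^-1 else x l.1).

Definition decidable_membership (n : nat) (x : 'I_n -> K) (N : set K) : Prop :=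
  exists2 d : 1.-tuple nat -> nat, recursive d &
    forall w : word n, d [tuple word_code w] = `[< N (word_value x w) >].

Definition decidable_word_problem (n : nat) (x : 'I_n -> K) : Prop :=
  decidable_membership x [set 1].

End Groups.

Section HNN.
Variables (G : groupType) (A : set G) (phi : G -> G).

(* inl g is an element of G, inr false is t and inr true is t^-1. *)
Definition hnn_letter : Type := (G + bool)%type.
HB.instance Definition _ := Choice.on hnn_letter.

(* The congruence defining < G, t | t^-1 a t = phi a (a in A) >. *)
Inductive hnn_cong : seq hnn_letter -> seq hnn_letter -> Prop :=
| hnn_refl u : hnn_cong u u
| hnn_sym u v : hnn_cong u v -> hnn_cong v u
| hnn_trans v u w : hnn_cong u v -> hnn_cong v w -> hnn_cong u w
| hnn_cat u u' v v' :
    hnn_cong u u' -> hnn_cong v v' -> hnn_cong (u ++ v) (u' ++ v')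
| hnn_one : hnn_cong [:: inl 1] [::]
| hnn_mul g h : hnn_cong [:: inl g; inl h] [:: inl (g * h)]
| hnn_tVt b : hnn_cong [:: inr b; inr (~~ b)] [::]
| hnn_conj a : A a ->
    hnn_cong [:: inr true; inl a; inr false] [:: inl (phi a)].

Definition hnn_rel (u v : seq hnn_letter) : bool := `[< hnn_cong u v >].

Lemma hnn_rel_refl : reflexive hnn_rel.
Proof. by move=> u; apply/asboolP; apply: hnn_refl. Qed.

Lemma hnn_rel_sym : symmetric hnn_rel.
Proof. by move=> u v; apply/asboolP/asboolP; apply: hnn_sym. Qed.

Lemma hnn_rel_trans : transitive hnn_rel.
Proof.
by move=> v u w /asboolP uv /asboolP vw; apply/asboolP; apply: hnn_trans uv vw.
Qed.

Definition hnn_equiv : equiv_rel (seq hnn_letter) :=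
  EquivRel hnn_rel hnn_rel_refl hnn_rel_sym hnn_rel_trans.

Definition hnn : Type := {eq_quot hnn_equiv}.
HB.instance Definition _ := Choice.on hnn.
HB.instance Definition _ := EqQuotient.on hnn.

Definition hnn_class (u : seq hnn_letter) : hnn := \pi_hnn u.

Lemma hnn_classP u v : hnn_class u = hnn_class v <-> hnn_cong u v.
Proof.
by split=> [/eqP|uv]; [rewrite eqmodE => /asboolP|apply/eqP; rewrite eqmodE; apply/asboolP].
Qed.

Lemma hnn_classK (x : hnn) : hnn_class (repr x) = x.
Proof. exact: reprK. Qed.

Lemma hnn_repr u : hnn_cong (repr (hnn_class u)) u.
Proof. by apply/hnn_classP; rewrite hnn_classK. Qed.

Definition hnn_letter_inv (l : hnn_letter) : hnn_letter :=
  match l with inl g => inl g^-1 | inr b => inr (~~ b) end.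

Definition hnn_word_inv (u : seq hnn_letter) := rev (map hnn_letter_inv u).

Lemma hnn_invl u : hnn_cong (hnn_word_inv u ++ u) [::].
Proof.
elim: u => [|l u IH]; first exact: hnn_refl.
rewrite /hnn_word_inv /= rev_cons cat_rcons -/(hnn_word_inv u).
apply: hnn_trans IH; apply: hnn_cat; first exact: hnn_refl.
rewrite -[l :: u]cat1s -[_ :: _]cat1s catA -[u in X in hnn_cong _ X]cat0s.
apply: hnn_cat; last exact: hnn_refl.
case: l => [g|b] /=.
  apply: hnn_trans (hnn_mul _ _) _; rewrite mulVg; exact: hnn_one.
by have := hnn_tVt (~~ b); rewrite negbK.
Qed.

Definition hnn_mulg (x y : hnn) : hnn := hnn_class (repr x ++ repr y).
Definition hnn_invg (x : hnn) : hnn := hnn_class (hnn_word_inv (repr x)).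

Lemma hnn_mulgE u v : hnn_mulg (hnn_class u) (hnn_class v) = hnn_class (u ++ v).
Proof. by apply/hnn_classP; apply: hnn_cat; apply: hnn_repr. Qed.

Lemma hnn_mulgA : associative hnn_mulg.
Proof.
move=> x y z; rewrite -[x]hnn_classK -[y]hnn_classK -[z]hnn_classK.
by rewrite !hnn_mulgE catA.
Qed.

Lemma hnn_mul1g : left_id (hnn_class [::]) hnn_mulg.
Proof. by move=> x; rewrite -[x]hnn_classK hnn_mulgE. Qed.

Lemma hnn_mulg1 : right_id (hnn_class [::]) hnn_mulg.
Proof. by move=> x; rewrite -[x]hnn_classK hnn_mulgE cats0. Qed.

Lemma hnn_mulVg : left_inverse (hnn_class [::]) hnn_invg hnn_mulg.
Proof.
move=> x; rewrite -[X in hnn_mulg _ X]hnn_classK /hnn_invg hnn_mulgE.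
by apply/hnn_classP; apply: hnn_invl.
Qed.

Lemma hnn_mulgV : right_inverse (hnn_class [::]) hnn_invg hnn_mulg.
Proof.
move=> x; rewrite -[LHS]hnn_mul1g -{1}(hnn_mulVg (hnn_invg x)).
by rewrite -hnn_mulgA (hnn_mulgA (hnn_invg x)) hnn_mulVg hnn_mul1g hnn_mulVg.
Qed.

HB.instance Definition _ := isGroup.Build hnn
  hnn_mulgA hnn_mul1g hnn_mulg1 hnn_mulVg hnn_mulgV.

Definition hnn_base (g : G) : hnn := hnn_class [:: inl g].
Definition hnn_stable : hnn := hnn_class [:: inr false].

Lemma hnn_baseM : {morph hnn_base : g h / g * h}.
Proof.
move=> g h; apply/esym; rewrite [LHS]hnn_mulgE.
by apply/hnn_classP; apply: hnn_mul.
Qed.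

Lemma hnn_stableJ a : A a -> hnn_base a ^ hnn_stable = hnn_base (phi a).
Proof.
move=> Aa; rewrite conjgE.
have -> : hnn_stable^-1 = hnn_class [:: inr true].
  apply: (mulIg hnn_stable); rewrite mulVg; apply/esym.
  by rewrite [LHS]hnn_mulgE; apply/hnn_classP; apply: (hnn_tVt true).
rewrite [_ * hnn_stable]hnn_mulgE [LHS]hnn_mulgE.
by apply/hnn_classP; apply: hnn_conj.
Qed.

(* The stable letter is the last generator. *)
Definition hnn_gen (n : nat) (x : 'I_n -> G) (i : 'I_n.+1) : hnn :=
  if unlift ord_max i is Some j then hnn_base (x j) else hnn_stable.

End HNN.

(* Main.v *)
(** A word over [G] and [t] is read from right to left while a product
    [g0 t^e1 g1 ... t^ek gk] is maintained; prepending [t^e] cancels a pinch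
    [t^e g0 t^-e] as soon as one appears. This is an action on such products
    that respects the defining relations up to moving elements of [A] and [B]
    across the stable letters, which gives Britton's lemma without choosing
    transversals. Since [A] and [B] lie in the monoid [N = M /\ G], neither
    those moves nor the cancellation of pinches can lead out of [N], so a word
    represents an element of [M] iff all [gi] obtained from it are in [N].
    The action is computable: membership in [A] and [B] detects pinches, and
    the image of [a] in [A] is found by searching, with the word problem of
    [G], for an expression of [a^-1] in the generators of [A]. *)
Require Import Defs.
From mathcomp Require Import all_boot.
From mathcomp Require Import boolp classical_sets functions cardinality.

Set Implicit Arguments.
Unset Strict Implicit.
Unset Printing Implicit Defensive.

(** * Closure properties of recursive functions *)

Lemma recursive_ext k (f g : k.-tuple nat -> nat) :
  f =1 g -> recursive f -> recursive g.
Proof. by move=> /funext ->. Qed.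

Definition recursive1 (F : nat -> nat) :=
  recursive (fun v : 1.-tuple nat => F (thead v)).

Lemma recursive_app k F (f : k.-tuple nat -> nat) :
  recursive1 F -> recursive f -> recursive (fun v => F (f v)).
Proof.
move=> rF rf; have /= := recursive_comp rF (fun=> rf).
by apply: recursive_ext => v; rewrite /thead tnth_mktuple.
Qed.

Lemma recursive_const k c : recursive (fun _ : k.-tuple nat => c).
Proof.
elim: c => [|c IHc]; last exact: recursive_app recursive_succ IHc.
by apply: (recursive_comp (g := fun _ _ => 0) recursive_zero); case.
Qed.

(** [recursive_prim] composed with [h v :: v]: the bound becomes an arbitrary recursive function,
    and the step sees the counter, the running value and all of [v]. *)
Lemma recursive_nat_rect k (f h : k.-tuple nat -> nat)
    (g : k.+2.-tuple nat -> nat) :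
  recursive f -> recursive g -> recursive h ->
  recursive (fun v => nat_rect (fun=> nat) (f v)
    (fun m r => g [tuple of m :: r :: v]) (h v)).
Proof.
move=> rf rg rh.
pose a (i : 'I_k.+1) v := if unlift ord0 i is Some j then tnth v j else h v.
have ra i : recursive (a i).
  by rewrite /a; case: unlift => [j|//]; apply: recursive_proj.
have aE v : [tuple a i v | i < k.+1] = [tuple of h v :: v].
  apply: eq_from_tnth => i; rewrite tnth_mktuple /a.
  by case: unliftP => [j ->|->]; rewrite ?tnthS ?tnth0.
have := recursive_comp (recursive_prim rf rg) ra.
apply: recursive_ext => v; rewrite aE theadE.
suff -> : [tuple of behead [tuple of h v :: v]] = v.
  congr nat_rect; apply: funext => m; apply: funext => r.
  by congr g; apply: val_inj.
by apply: val_inj.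
Qed.

(** Primitive recursion over the truth value, 0 or 1: the base value is [g], and the only possible
    step drops counter and running value and returns [f]. *)
Lemma recursive_if k (b : k.-tuple nat -> bool) (f g : k.-tuple nat -> nat) :
  recursive (fun v => b v : nat) -> recursive f -> recursive g ->
  recursive (fun v => if b v then f v else g v).
Proof.
move=> rb rf rg.
have rp : recursive (fun w : k.+2.-tuple nat =>
    f [tuple tnth w (lift ord0 (lift ord0 i)) | i < k]).
  by apply: recursive_comp => // i; apply: recursive_proj.
have := recursive_nat_rect rg rp rb; apply: recursive_ext => v.
case: (b v) => //=; congr f; apply: eq_from_tnth => i.
by rewrite tnth_mktuple !tnthS.
Qed.

Lemma recursive_iter k F (f g : k.-tuple nat -> nat) :
  recursive1 F -> recursive f -> recursive g ->
  recursive (fun v => iter (f v) F (g v)).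
Proof.
move=> rF rf rg.
have rp : recursive (fun w : k.+2.-tuple nat => F (tnth w (lift ord0 ord0))).
  by apply: recursive_app => //; apply: recursive_proj.
have := recursive_nat_rect rg rp rf; apply: recursive_ext => v.
by elim: (f v) => //= m ->; rewrite tnthS tnth0.
Qed.

Lemma recursive_add k (f g : k.-tuple nat -> nat) :
  recursive f -> recursive g -> recursive (fun v => f v + g v).
Proof.
move=> rf rg; have := recursive_iter recursive_succ rf rg.
by apply: recursive_ext => v; rewrite iter_succn addnC.
Qed.

Lemma recursive_pred k (f : k.-tuple nat -> nat) :
  recursive f -> recursive (fun v => (f v).-1).
Proof.
move=> rf.
have := recursive_nat_rect (recursive_const _ 0) (recursive_proj ord0) rf.
by apply: recursive_ext => v; case: (f v).
Qed.

Lemma recursive1_pred : recursive1 predn.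
Proof. exact/recursive_pred/recursive_proj. Qed.

Lemma recursive_sub k (f g : k.-tuple nat -> nat) :
  recursive f -> recursive g -> recursive (fun v => f v - g v).
Proof.
move=> rf rg; have := recursive_iter recursive1_pred rg rf.
by apply: recursive_ext => v; rewrite iter_predn.
Qed.

Lemma recursive1_double : recursive1 double.
Proof.
have rp : recursive (fun v : 1.-tuple nat => thead v) := recursive_proj _.
by apply: recursive_ext (recursive_add rp rp) => v; rewrite addnn.
Qed.

(** Rests on the recurrence [m.+1./2 = m - m./2]. *)
Lemma recursive1_half : recursive1 half.
Proof.
have rp : recursive (fun v : 1.-tuple nat => thead v) := recursive_proj _.
have := recursive_nat_rect (recursive_const _ 0)
  (recursive_sub (recursive_proj ord0) (recursive_proj (inord 1))) rp.
apply: recursive_ext => v; elim: (thead v) => //= m ->.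
rewrite (_ : inord 1 = lift ord0 ord0); last first.
  by apply: val_inj; rewrite /= inordK.
rewrite !(tnthS, tnth0) uphalf_half -{1}[m]odd_double_half.
by rewrite -addnn addnA addnK.
Qed.

Lemma recursive1_odd : recursive1 (fun m => odd m).
Proof.
have rp : recursive (fun v : 1.-tuple nat => thead v) := recursive_proj _.
have := recursive_sub rp (recursive_app recursive1_double
  (recursive_app recursive1_half rp)).
by apply: recursive_ext => v; rewrite -{1}[thead v]odd_double_half addnK.
Qed.

(** * Codes of lists and their decomposition *)

(** The step of [CodeSeq.code], so that [code (m :: s) = cons_code m (code s)]. It also serves as
    the pairing function. *)
Definition cons_code m c := 2 ^ m * c.*2.+1.

Lemma cons_code_gt0 m c : 0 < cons_code m c.
Proof. by rewrite muln_gt0 expn_gt0. Qed.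

Lemma ltn_cons_code m c : c < cons_code m c.
Proof.
rewrite -[X in X < _]mul1n; apply: (@leq_trans (1 * c.*2.+1)).
  by rewrite !mul1n ltnS -addnn leq_addr.
by rewrite leq_mul ?expn_gt0.
Qed.

Lemma recursive_cons k (f g : k.-tuple nat -> nat) :
  recursive f -> recursive g -> recursive (fun v => cons_code (f v) (g v)).
Proof.
move=> rf rg; have := recursive_iter recursive1_double rf
  (recursive_app recursive_succ (recursive_app recursive1_double rg)).
apply: recursive_ext => v; rewrite /cons_code.
by elim: (f v) => [|m /= ->]; rewrite ?mul1n // expnS -mulnA mul2n.
Qed.

Lemma iter_half_cons_code j m c :
  j <= m -> iter j half (cons_code m c) = cons_code (m - j) c.
Proof.
elim: j => [|j IHj] lejm; first by rewrite subn0.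
rewrite /= IHj ?(ltnW lejm) // /cons_code -[m - j]prednK ?subn_gt0 //.
by rewrite expnS -mulnA mul2n doubleK subnS.
Qed.

Lemma odd_cons_code m c : odd (cons_code m c) = (m == 0).
Proof. by rewrite /cons_code oddM oddX /= odd_double orbF andbT. Qed.

(** Makes the search for the exponent of 2 in [c] regular. For [c = 0], the code of the empty list,
    no iterate is odd; there the else branch [c] is itself the required zero. *)
Lemma halve_exists c :
  exists m, (if odd (iter m half c) then 0 else c) == 0.
Proof.
rewrite -[c]CodeSeq.decodeK.
case: (CodeSeq.decode c) => [|m s]; first by exists 0.
by exists m; rewrite iter_half_cons_code // odd_cons_code subnn.
Qed.

(** The exponent of 2 in [c], and 0 for [c = 0]. *)
Definition head_code c := ex_minn (halve_exists c).
Definition behead_code c := (iter (head_code c) half c)./2.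

Lemma recursive_head k (f : k.-tuple nat -> nat) :
  recursive f -> recursive (fun v => head_code (f v)).
Proof.
suff: recursive1 head_code by apply: recursive_app.
pose h (v : 2.-tuple nat) :=
  if odd (iter (tnth v ord0) half (tnth v (lift ord0 ord0))) then 0
  else tnth v (lift ord0 ord0).
have rh : recursive h.
  apply: recursive_if; [|exact: recursive_const|exact: recursive_proj].
  apply: (recursive_app recursive1_odd).
  by apply: recursive_iter recursive1_half _ _; apply: recursive_proj.
have h0 (v : 1.-tuple nat) : exists m, h [tuple of m :: v] == 0.
  have [m mP] := halve_exists (thead v); exists m.
  by rewrite /h tnth0 tnthS.
have := recursive_min h0 rh; apply: recursive_ext => v.
(* Both minima concern the same condition, presented differently; each bounds the other. *)
rewrite /head_code; case: ex_minnP => m hm minm; case: ex_minnP => m' hm' minm'.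
apply/eqP; rewrite eqn_leq minm' ?minm //; first by rewrite /h tnth0 tnthS.
by move: hm; rewrite /h tnth0 tnthS.
Qed.

Lemma recursive_behead k (f : k.-tuple nat -> nat) :
  recursive f -> recursive (fun v => behead_code (f v)).
Proof.
move=> rf; apply: (recursive_app recursive1_half).
exact: recursive_iter recursive1_half (recursive_head rf) rf.
Qed.

Lemma head_codeK m c : head_code (cons_code m c) = m.
Proof.
rewrite /head_code; case: ex_minnP => j hj minj.
apply/eqP; rewrite eqn_leq minj; last first.
  by rewrite iter_half_cons_code // odd_cons_code subnn.
rewrite leqNgt; apply/negP => ltjm; move: hj.
rewrite iter_half_cons_code ?(ltnW ltjm) // odd_cons_code subn_eq0.
by rewrite leqNgt ltjm gtn_eqF ?cons_code_gt0.
Qed.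

Lemma behead_codeK m c : behead_code (cons_code m c) = c.
Proof.
rewrite /behead_code head_codeK iter_half_cons_code // subnn /cons_code mul1n.
by rewrite /= uphalf_double.
Qed.

Lemma behead_code0 : behead_code 0 = 0.
Proof. by rewrite /behead_code iter_fix. Qed.

(** * Computable functions on encodable types *)

(** A bare numbering; decoders are supplied only where a search needs them. Pairs and nonempty lists
    are both coded by [cons_code], so one set of recursive functions serves both. *)
Class encodable (T : Type) := encode : T -> nat.

#[local] Instance encodable_nat : encodable nat := id.
#[local] Instance encodable_bool : encodable bool := nat_of_bool.
#[local] Instance encodable_prod (T U : Type) {cT : encodable T}
    {cU : encodable U} :
  encodable (T * U) := fun p => cons_code (encode p.1) (encode p.2).
#[local] Instance encodable_seq (T : Type) {cT : encodable T} :
    encodable (seq T) :=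
  fun s => CodeSeq.code (map encode s).

(** The values of [F] at numbers that are not codes are left open. *)
Definition computable (T U : Type) {cT : encodable T} {cU : encodable U}
    (f : T -> U) :=
  exists2 F, recursive1 F & forall t, F (encode t) = encode (f t).

Section Computable.
Context {X T U : Type}.
Context {cX : encodable X} {cT : encodable T} {cU : encodable U}.

Lemma computable_ext (f g : T -> U) : f =1 g -> computable f -> computable g.
Proof. by move=> /funext ->. Qed.

Lemma computable_id : computable (fun x : T => x).
Proof. by exists id => //; apply: recursive_proj. Qed.

Lemma computable_const (u : U) : computable (fun _ : T => u).
Proof. by exists (fun=> encode u) => //; apply: recursive_const. Qed.

Lemma computable_comp (g : T -> U) (f : X -> T) :
  computable g -> computable f -> computable (fun x => g (f x)).
Proof.
move=> [G rG GE] [F rF FE]; exists (G \o F) => [|t]; last by rewrite /= FE GE.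
exact: recursive_app rG rF.
Qed.

Lemma computable_pair (f : X -> T) (g : X -> U) :
  computable f -> computable g -> computable (fun x => (f x, g x)).
Proof.
move=> [F rF FE] [G rG GE]; exists (fun c => cons_code (F c) (G c)).
  exact: recursive_cons.
by move=> x; rewrite FE GE.
Qed.

Lemma computable_fst (f : X -> T * U) :
  computable f -> computable (fun x => (f x).1).
Proof.
move=> [F rF FE].
exists (fun c => head_code (F c)); first exact: recursive_head.
by move=> x; rewrite FE head_codeK.
Qed.

Lemma computable_snd (f : X -> T * U) :
  computable f -> computable (fun x => (f x).2).
Proof.
move=> [F rF FE].
exists (fun c => behead_code (F c)); first exact: recursive_behead.
by move=> x; rewrite FE behead_codeK.
Qed.

Lemma computable_if (b : X -> bool) (f g : X -> T) :
  computable b -> computable f -> computable g ->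
  computable (fun x => if b x then f x else g x).
Proof.
move=> [D rD DE] [F rF FE] [G rG GE].
exists (fun c => if odd (D c) then F c else G c).
  by apply: recursive_if => //; apply: (recursive_app recursive1_odd).
by move=> x; rewrite DE /encode /encodable_bool oddb; case: (b x).
Qed.

Lemma computable_cons (f : X -> T) (g : X -> seq T) :
  computable f -> computable g -> computable (fun x => f x :: g x).
Proof.
move=> [F rF FE] [G rG GE]; exists (fun c => cons_code (F c) (G c)).
  exact: recursive_cons.
by move=> x; rewrite FE GE.
Qed.

Lemma computable_behead (f : X -> seq T) :
  computable f -> computable (fun x => behead (f x)).
Proof.
move=> [F rF FE].
exists (fun c => behead_code (F c)); first exact: recursive_behead.
move=> x; rewrite FE; case: (f x) => [|t s]; first exact: behead_code0.
exact: behead_codeK.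
Qed.

Lemma encode_nilp (s : seq T) : (encode s == 0) = nilp s.
Proof. by case: s => //= t s; apply: gtn_eqF; apply: cons_code_gt0. Qed.

End Computable.

Lemma recursive1_is_zero : recursive1 (fun m => m == 0).
Proof.
have := recursive_sub (recursive_const 1 1) (recursive_proj ord0).
by apply: recursive_ext => v; rewrite /thead; case: (tnth _ _).
Qed.

(** * Computable operations on lists *)

Section ComputableLists.
Context {X T U : Type}.
Context {cX : encodable X} {cT : encodable T} {cU : encodable U}.

Lemma computable_nilp (f : X -> seq T) :
  computable f -> computable (fun x => nilp (f x)).
Proof.
move=> [F rF FE]; exists (fun c => F c == 0).
  exact: (recursive_app recursive1_is_zero).
by move=> x; rewrite FE encode_nilp.
Qed.

Lemma computable_head (t0 : T) (f : X -> seq T) :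
  computable f -> computable (fun x => head t0 (f x)).
Proof.
move=> [F rF FE].
exists (fun c => if F c == 0 then encode t0 else head_code (F c)).
  apply: recursive_if (recursive_const _ _) (recursive_head rF).
  exact: (recursive_app recursive1_is_zero).
move=> x; rewrite FE encode_nilp; case: (f x) => //= t s; exact: head_codeK.
Qed.

Lemma computable_iter (n : X -> nat) (h : X * T -> T) (f : X -> T) :
  computable n -> computable h -> computable f ->
  computable (fun x => iter (n x) (fun t => h (x, t)) (f x)).
Proof.
move=> [N rN NE] [H rH HE] [F rF FE].
exists (fun c => iter (N c) (fun r => H (cons_code c r)) (F c)).
  (* The entries of [w] are the counter, the running value and the code of [x], in this order. *)
  have rg : recursive (fun w : 3.-tuple nat =>
      H (cons_code (tnth w (lift ord0 (lift ord0 ord0)))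
        (tnth w (lift ord0 ord0)))).
    by apply: (recursive_app rH); apply: recursive_cons; apply: recursive_proj.
  have := recursive_nat_rect rF rg rN; apply: recursive_ext => v.
  by elim: (N _) => //= m ->; rewrite !(tnthS, tnth0).
move=> x; rewrite NE FE /encode /encodable_nat.
by elim: (n x) => //= m ->; apply: (HE (_, _)).
Qed.

End ComputableLists.

Section ComputableFolds.
Context {X T U : Type} {cX : encodable X} {cT : encodable T} {cU : encodable U}.

Lemma size_le_encode (s : seq T) : size s <= encode s.
Proof.
elim: s => //= t s IHs; apply: leq_ltn_trans IHs _.
exact: (ltn_cons_code (encode t)).
Qed.

(** A fold iterates [step] on the pair of accumulator and remaining list. This pair is stationary
    once the list is empty, so any bound on the length serves as the number of iterations. [t0] is
    only the default of [head]. *)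
Lemma computable_foldl (t0 : T) (h : X * U * T -> U) (z : X -> U)
    (s : X -> seq T) :
  computable h -> computable z -> computable s ->
  computable (fun x => foldl (fun u t => h (x, u, t)) (z x) (s x)).
Proof.
move=> ch cz cs.
pose step (p : X * (U * seq T)) := let: (x, (u, r)) := p in
  if nilp r then (u, r) else (h (x, u, head t0 r), behead r).
have cstep : computable step.
  have c1 : computable (fun p : X * (U * seq T) => p.1).
    exact/computable_fst/computable_id.
  have c2 : computable (fun p : X * (U * seq T) => p.2).
    exact/computable_snd/computable_id.
  have c21 := computable_fst c2; have c22 := computable_snd c2.
  apply: (@computable_ext _ _ _ _ (fun p => if nilp p.2.2 then p.2 else
    (h (p.1, p.2.1, head t0 p.2.2), behead p.2.2))) => [[x [u r]] //|].
  apply: computable_if => //; first exact: computable_nilp.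
  apply: computable_pair; last exact: computable_behead.
  apply: (computable_comp ch).
  apply: computable_pair; last exact: computable_head.
  exact: computable_pair.
(* The code of a list bounds its length and is available without further computation. *)
have csize : computable (fun x => encode (s x)).
  by have [S rS SE] := cs; exists S.
have := computable_fst (computable_iter csize cstep (computable_pair cz cs)).
apply: computable_ext => x.
move: (encode (s x)) (size_le_encode (s x)) => m.
elim: m (s x) (z x) => [|m IHm] r u.
  by case: r.
rewrite iterSr; case: r => [|t r] ltrm; last by rewrite IHm.
by rewrite iter_fix.
Qed.

End ComputableFolds.

Ltac computable_projection :=
  lazymatch goal with
  | |- computable (fun x => fst (@?f x)) =>
      apply: (computable_fst (f := f)); computable_projection
  | |- computable (fun x => snd (@?f x)) =>
      apply: (computable_snd (f := f)); computable_projection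
  | |- computable fst =>
      apply: (computable_fst (f := id)); computable_projection
  | |- computable snd =>
      apply: (computable_snd (f := id)); computable_projection
  | |- computable id => exact: computable_id
  | |- computable (fun x => x) => exact: computable_id
  end.

Section ComputableListOperations.
Context {X T U : Type} {cX : encodable X} {cT : encodable T} {cU : encodable U}.

Lemma computable_rev (t0 : T) (s : X -> seq T) :
  computable s -> computable (fun x => rev (s x)).
Proof.
move=> cs; have ch : computable (fun p : X * seq T * T => p.2 :: p.1.2).
  by apply: computable_cons; computable_projection.
have := computable_foldl t0 ch (computable_const (@nil T)) cs.
apply: computable_ext => x /=.
by rewrite -[s x in LHS]revK foldl_rev /=; elim: (rev _) => //= t r ->.
Qed.

(** A right fold is a left fold of the reversed list. *)
Lemma computable_foldr (t0 : T) (h : X * T * U -> U) (z : X -> U)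
    (s : X -> seq T) :
  computable h -> computable z -> computable s ->
  computable (fun x => foldr (fun t u => h (x, t, u)) (z x) (s x)).
Proof.
move=> ch cz cs.
have ch' : computable (fun p : X * U * T => h (p.1.1, p.2, p.1.2)).
  apply: (computable_comp ch); repeat apply: computable_pair;
  computable_projection.
have := computable_foldl t0 ch' cz (computable_rev t0 cs).
by apply: computable_ext => x /=; rewrite foldl_rev.
Qed.

End ComputableListOperations.

Section ComputableMap.
Context {X T U : Type} {cX : encodable X} {cT : encodable T} {cU : encodable U}.

Lemma computable_map (t0 : T) (h : T -> U) (s : X -> seq T) :
  computable h -> computable s -> computable (fun x => map h (s x)).
Proof.
move=> ch cs.
have ch' : computable (fun p : X * T * seq U => h p.1.2 :: p.2).
  apply: computable_cons; first apply: (computable_comp ch);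
  computable_projection.
have := computable_foldr t0 ch' (computable_const (@nil U)) cs.
by apply: computable_ext.
Qed.

Lemma computable_filter (t0 : T) (h : T -> bool) (s : X -> seq T) :
  computable h -> computable s -> computable (fun x => filter h (s x)).
Proof.
move=> ch cs.
have ch' : computable (fun p : X * T * seq T =>
    if h p.1.2 then p.1.2 :: p.2 else p.2).
  apply: computable_if; [apply: (computable_comp ch)|apply: computable_cons|];
  computable_projection.
have := computable_foldr t0 ch' (computable_const (@nil T)) cs.
by apply: computable_ext.
Qed.

Lemma computable_cat (t0 : T) (r s : X -> seq T) :
  computable r -> computable s -> computable (fun x => r x ++ s x).
Proof.
move=> cr cs.
have ch : computable (fun p : X * T * seq T => p.1.2 :: p.2).
  apply: computable_cons;
  computable_projection.
have := computable_foldr t0 ch cs cr.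
by apply: computable_ext => x; elim: (r x) => //= t u ->.
Qed.

Lemma computable_and (b c : X -> bool) :
  computable b -> computable c -> computable (fun x => b x && c x).
Proof.
move=> cb cc; have := computable_if cb cc (computable_const false).
by apply: computable_ext => x; case: (b x).
Qed.

Lemma computable_not (b : X -> bool) :
  computable b -> computable (fun x => ~~ b x).
Proof.
move=> cb.
apply: (@computable_ext _ _ _ _ (fun x => if b x then false else true)).
  by move=> x; case: (b x).
by apply: computable_if => //; apply: computable_const.
Qed.

End ComputableMap.

Section ComputableAll.
Context {X T U : Type} {cX : encodable X} {cT : encodable T} {cU : encodable U}.

Lemma computable_all (t0 : T) (h : T -> bool) (s : X -> seq T) :
  computable h -> computable s -> computable (fun x => all h (s x)).
Proof.
move=> ch cs.
have ch' : computable (fun p : X * T * bool => h p.1.2 && p.2).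
  apply: computable_and; first apply: (computable_comp ch);
  computable_projection.
have := computable_foldr t0 ch' (computable_const true) cs.
by apply: computable_ext.
Qed.

Lemma computable_recursive1 (F : nat -> nat) (f : X -> nat) :
  recursive1 F -> computable f -> computable (fun x => F (f x)).
Proof. by move=> rF; apply: computable_comp; exists F. Qed.

Lemma computable_odd (f : X -> nat) :
  computable f -> computable (fun x => odd (f x)).
Proof. by apply: computable_comp; exists odd => //; apply: recursive1_odd. Qed.

Lemma computable_ltn (f : X -> nat) c :
  computable f -> computable (fun x => f x < c).
Proof.
apply: (computable_comp (g := fun m => m < c)).
exists (fun m => m.+1 - c == 0) => //.
apply: (recursive_app recursive1_is_zero).
apply: recursive_sub (recursive_const _ _).
exact: (recursive_app recursive_succ (recursive_proj _)).
Qed.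

(** The list is fixed, so the lookup is a finite nest of case distinctions. *)
Lemma computable_nth (t0 : T) (s : seq T) (f : X -> nat) :
  computable f -> computable (fun x => nth t0 s (f x)).
Proof.
elim: s f => [|t s IHs] f cf.
  by apply: computable_ext (computable_const t0) => x; rewrite nth_nil.
have := computable_if (computable_ltn 1 cf) (computable_const t)
  (IHs _ (computable_recursive1 recursive1_pred cf)).
by apply: computable_ext => x; case: (f x).
Qed.

(** * Unbounded search *)

Lemma tuple1_eta (v : 1.-tuple nat) : v = [tuple thead v].
Proof. by apply: eq_from_tnth => i; rewrite (ord1 i). Qed.

(** Minimization has to succeed at every number, not only at codes; since each number codes an
    element of [X], the existence hypothesis covers all inputs. The least witness is then decoded by
    [dT]. *)
Lemma computable_search (dX : nat -> X) (dT : nat -> T) (p : X * T -> bool) :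
  cancel dX encode -> cancel dT encode -> cancel encode dT -> computable p ->
  (forall x, exists t, p (x, t)) ->
  exists2 f, computable f & forall x, p (x, f x).
Proof.
move=> dXK dTK encK [P rP PE] px.
(* Minimization looks for zeros, hence the truth value is subtracted from 1. *)
pose q (w : 2.-tuple nat) :=
  1 - P (cons_code (tnth w (lift ord0 ord0)) (tnth w ord0)).
have rq : recursive q.
  apply: recursive_sub; first exact: recursive_const.
  by apply: (recursive_app rP); apply: recursive_cons; apply: recursive_proj.
have qE x t : q [tuple of encode t :: [tuple encode x]] = ~~ p (x, t).
  by rewrite /q tnthS !tnth0 (PE (x, t)); case: (p _).
have q0 (v : 1.-tuple nat) : exists m, q [tuple of m :: v] == 0.
  have [t pt] := px (dX (thead v)); exists (encode t).
  rewrite (_ : v = [tuple encode (dX (thead v))]) ?qE ?pt //.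
  by rewrite dXK -tuple1_eta.
exists (fun x => dT (ex_minn (q0 [tuple encode x]))).
  exists (fun c => ex_minn (q0 [tuple c])).
    have := recursive_min q0 rq; apply: recursive_ext => v.
    congr (ex_minn (q0 _)).
    by rewrite -tuple1_eta.
  by move=> x; rewrite dTK.
move=> x; case: ex_minnP => m qm _.
by have := qE x (dT m); rewrite dTK (eqP qm); case: (p _).
Qed.

End ComputableAll.

Lemma encode_seq_nat (s : seq nat) : encode s = CodeSeq.code s.
Proof. by rewrite /encode /encodable_seq map_id. Qed.

(** * Britton reduction in HNN extensions *)

Local Open Scope group_scope.
Local Open Scope classical_set_scope.

Section Britton.
Variables (G : groupType) (A B : set G) (phi psi : G -> G).
Hypotheses (A_subgroup : is_subgroup A) (B_subgroup : is_subgroup B).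
Hypothesis phi_morph : {in A &, {morph phi : a b / a * b}}.
Hypotheses (phi_fun : set_fun A B phi) (psi_fun : set_fun B A psi).
Hypotheses (phiK : {in A, cancel phi psi}) (psiK : {in B, cancel psi phi}).

(* As in hnn_letter, e = true encodes t^-1, so that t^e a = assoc_iso e a t^e
   for all a in assoc e. *)
Definition assoc (e : bool) : set G := if e then A else B.
Definition assoc_iso (e : bool) : G -> G := if e then phi else psi.

Lemma assoc_subgroup e : is_subgroup (assoc e).
Proof. by case: e. Qed.

Lemma assoc1 e : assoc e 1.
Proof. by have [/set_mem] := assoc_subgroup e. Qed.

Lemma assocM e g h : assoc e g -> assoc e h -> assoc e (g * h).
Proof.
move=> /mem_set Dg /mem_set Dh; apply: set_mem.
exact: (group_closedM (assoc_subgroup e)).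
Qed.

Lemma assocV e g : assoc e g -> assoc e g^-1.
Proof.
move=> /mem_set Dg; apply: set_mem; exact: (group_closedV (assoc_subgroup e)).
Qed.

Lemma assoc_isoP e g : assoc e g -> assoc (~~ e) (assoc_iso e g).
Proof. by case: e; [apply: phi_fun | apply: psi_fun]. Qed.

Lemma assoc_isoK e g : assoc e g -> assoc_iso (~~ e) (assoc_iso e g) = g.
Proof. by case: e => /mem_set; [apply: phiK | apply: psiK]. Qed.

(** Only [phi] is assumed multiplicative; for [psi], both factors are written as images under
    [phi]. *)
Lemma assoc_isoM e g h : assoc e g -> assoc e h ->
  assoc_iso e (g * h) = assoc_iso e g * assoc_iso e h.
Proof.
case: e => /= Dg Dh; first by apply: phi_morph; apply: mem_set.
have ADg : A (psi g) by exact: psi_fun.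
have ADh : A (psi h) by exact: psi_fun.
rewrite -[g in LHS](psiK (mem_set Dg)) -[h in LHS](psiK (mem_set Dh)).
rewrite -phi_morph ?mem_set // phiK // mem_set //.
exact: (@assocM true).
Qed.

Lemma assoc_iso1 e : assoc_iso e 1 = 1.
Proof.
apply: (mulgI (assoc_iso e 1)).
by rewrite -assoc_isoM ?mulg1 //; apply: assoc1.
Qed.

Lemma assoc_isoV e g : assoc e g -> assoc_iso e g^-1 = (assoc_iso e g)^-1.
Proof.
move=> Dg; apply: (mulgI (assoc_iso e g)).
by rewrite -assoc_isoM ?mulgV ?assoc_iso1 //; apply: assocV.
Qed.

(* The pair (g, [:: (e1, g1); ...]) stands for g t^e1 g1 .... *)
Definition hnn_form : Type := (G * seq (bool * G))%type.

(* Equality of s and c s' modulo the relations t^e a = assoc_iso e a t^e only,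
   the tail [:: (e1, g1); ...] standing for t^e1 g1 .... *)
Fixpoint hnn_tail_eq (c : G) (s s' : seq (bool * G)) : Prop :=
  match s, s' with
  | [::], [::] => c = 1
  | (e, g) :: s, (e', g') :: s' => e = e' /\
      exists2 a, assoc e a &
        c = assoc_iso e a /\ hnn_tail_eq (g^-1 * a * g') s s'
  | _, _ => False
  end.

(** Equality of [g s] and [g' s'], rewritten as equality of [s] and [g^-1 g' s']. *)
Definition hnn_form_eq (p q : hnn_form) := hnn_tail_eq (p.1^-1 * q.1) p.2 q.2.

Lemma hnn_tail_eq_refl s : hnn_tail_eq 1 s s.
Proof.
elim: s => //= -[e g] s IHs; split=> //; exists 1; first exact: assoc1.
by rewrite assoc_iso1 mulg1 mulVg.
Qed.

Lemma hnn_tail_eq_sym c s s' : hnn_tail_eq c s s' -> hnn_tail_eq c^-1 s' s.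
Proof.
elim: s s' c => [|[e g] s IHs] [|[e' g'] s'] c //= => [->|].
  by rewrite invg1.
case=> <- [a Da [-> /IHs ss']]; split=> //; exists a^-1; first exact: assocV.
by rewrite assoc_isoV // !invgM invgK mulgA in ss' *.
Qed.

(** The elements [a] and [b] moved across a stable letter combine to [a * b], and [g^-1 a g'] times
    [g'^-1 b g''] is [g^-1 (a b) g'']. *)
Lemma hnn_tail_eq_trans c d s s' s'' :
  hnn_tail_eq c s s' -> hnn_tail_eq d s' s'' -> hnn_tail_eq (c * d) s s''.
Proof.
elim: s s' s'' c d => [|[e g] s IHs] [|[e' g'] s'] [|[e'' g''] s''] c d //=.
  by move=> -> ->; rewrite mulg1.
case=> <- [a Da [-> ss']] [<- [b Db [-> s's'']]]; split=> //.
exists (a * b); first exact: assocM.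
rewrite assoc_isoM //; split=> //; have := IHs _ _ _ _ ss' s's''.
by rewrite !mulgA mulgK.
Qed.

Lemma hnn_form_eq_refl p : hnn_form_eq p p.
Proof. by rewrite /hnn_form_eq mulVg; apply: hnn_tail_eq_refl. Qed.

Lemma hnn_form_eq_sym p q : hnn_form_eq p q -> hnn_form_eq q p.
Proof. by move=> /hnn_tail_eq_sym; rewrite invgM invgK. Qed.

Lemma hnn_form_eq_trans p q r :
  hnn_form_eq p q -> hnn_form_eq q r -> hnn_form_eq p r.
Proof.
move=> pq qr; have := hnn_tail_eq_trans pq qr.
by rewrite -mulgA mulVKg.
Qed.

(** * The action of words on reduced forms *)

(** Reducedness in the sense of Britton: no pinch [t^e g t^-e] with [g] in [assoc e]. *)
Fixpoint reduced (s : seq (bool * G)) : Prop :=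
  if s is (e, g) :: s' then
    (if s' is (e', _) :: _ then e' = ~~ e -> ~ assoc e g else True) /\ reduced s'
  else True.

Definition hnn_act (l : hnn_letter G) (p : hnn_form) : hnn_form :=
  match l with
  | inl g => (g * p.1, p.2)
  | inr e =>
    if p.2 is (e', g) :: s then
      if (e' == ~~ e) && `[< assoc e p.1 >] then (assoc_iso e p.1 * g, s)
      else (1, (e, p.1) :: p.2)
    else (1, (e, p.1) :: p.2)
  end.

Definition hnn_acts (u : seq (hnn_letter G)) (p : hnn_form) :=
  foldr hnn_act p u.

Lemma reduced_act l p : reduced p.2 -> reduced (hnn_act l p).2.
Proof.
case: l => [g|e] //=; case: p => [h [|[e' g] s]] //= [red reds].
case: ifP => //= /negbT; rewrite negb_and => /orP nD; split=> // ee' Dh.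
by case: nD; rewrite ?ee' ?eqxx // => /asboolPn.
Qed.

Lemma reduced_acts u p : reduced p.2 -> reduced (hnn_acts u p).2.
Proof. by move=> redp; elim: u => //= l u; apply: reduced_act. Qed.

(** The leading elements [h] and [h'] of equal forms differ by an element of the subgroup tested for
    a pinch, so either both forms cancel or neither does. After cancellation, the element [a] moved
    across the lost stable letter reappears between the new leading elements. *)
Lemma hnn_act_eq l p q :
  hnn_form_eq p q -> hnn_form_eq (hnn_act l p) (hnn_act l q).
Proof.
case: l => [g|e]; first by rewrite /hnn_form_eq /= invgM mulgA mulgVK.
case: p q => [h s] [h' s'] pq.
have push : hnn_form_eq (1, (e, h) :: s) (1, (e, h') :: s').
  rewrite /hnn_form_eq /= mulVg; split=> //; exists 1; first exact: assoc1.
  by rewrite assoc_iso1 mulg1.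
move: pq push; rewrite /hnn_form_eq /=.
case: s s' => [|[e1 g] s] [|[e2 g'] s'] //=.
case=> <- [a Da [hh' ss']] push.
have [e1e|] /= := eqVneq e1 (~~ e); last by move=> _; exact: push.
have Dhh' : assoc e (h^-1 * h').
  by rewrite hh' -[e]negbK -e1e; apply: assoc_isoP.
have -> : `[< assoc e h' >] = `[< assoc e h >].
  apply/asbool_equiv_eq; split=> Dh.
    rewrite -[h](mulVKg h') -[h'^-1 * h]invgK invgM invgK.
    by apply: assocM => //; apply: assocV.
  by rewrite -[h'](mulVKg h); apply: assocM.
case: asboolP => [Dh|_] /=; last exact: push.
suff -> : (assoc_iso e h * g)^-1 * (assoc_iso e h' * g') = g^-1 * a * g' by [].
rewrite invgM -!mulgA; congr (_ * _); rewrite !mulgA; congr (_ * _).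
have -> : h' = h * (h^-1 * h') by rewrite mulVKg.
rewrite assoc_isoM // mulKg hh'.
have -> : e = ~~ e1 by rewrite e1e negbK.
exact: assoc_isoK.
Qed.

Lemma hnn_acts_eq u p q :
  hnn_form_eq p q -> hnn_form_eq (hnn_acts u p) (hnn_acts u q).
Proof. by move=> pq; elim: u => //= l u; apply: hnn_act_eq. Qed.

(** If [t^-e] is pushed, [t^e] cancels it again. If [t^-e] cancels a leading [t^e], then [t^e]
    cannot cancel in turn, as this would put [g] in [assoc e] and contradict reducedness. It is
    pushed back, and the results agree after moving [a * assoc_iso (~~ e) h] across it. *)
Lemma hnn_acts_conj e a p : assoc e a -> reduced p.2 ->
  hnn_form_eq (hnn_acts [:: inr e; inl a; inr (~~ e)] p)
    (assoc_iso e a * p.1, p.2).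
Proof.
move=> Da; case: p => [h [|[e1 g] s]] /=.
  by rewrite eqxx mulg1 asboolT //= => _; apply: hnn_form_eq_refl.
rewrite negbK; have [->{e1}|_] /= := eqVneq e1 e; last first.
  by rewrite eqxx mulg1 asboolT //= => _; apply: hnn_form_eq_refl.
case: asboolP => [Dh|_] [red _] /=; last first.
  by rewrite eqxx mulg1 asboolT //=; apply: hnn_form_eq_refl.
have Dh' : assoc e (assoc_iso (~~ e) h).
  by rewrite -[e in assoc e]negbK; apply: assoc_isoP.
have Dah := assocM Da Dh'.
suff: hnn_form_eq (1, (e, a * (assoc_iso (~~ e) h * g)) :: s)
    (assoc_iso e a * h, (e, g) :: s).
  case: s red => [//|[e2 g2] s] red /=.
  case: eqVneq => [e2e|//]; case: asboolP => // Dahg.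
  case: (red e2e); rewrite mulgA in Dahg.
  rewrite -[g](mulKg (a * assoc_iso (~~ e) h)).
  by apply: assocM => //; apply: assocV.
rewrite /hnn_form_eq /= invg1 mul1g; split=> //.
exists (a * assoc_iso (~~ e) h) => //; split.
  by rewrite assoc_isoM // -{3}[e]negbK assoc_isoK.
by rewrite -mulgA -(mulgA a) mulVg; apply: hnn_tail_eq_refl.
Qed.

(** This takes the place of Britton's lemma. For concatenations, the right factors give forms that
    agree only up to [hnn_form_eq], which [hnn_acts_eq] carries through the left factor. *)
Lemma hnn_cong_acts u v : hnn_cong A phi u v -> forall p, reduced p.2 ->
  hnn_form_eq (hnn_acts u p) (hnn_acts v p).
Proof.
elim=> {u v} [u|u v _ IHuv|v u w _ IHuv _ IHvw|u u' v v' _ IHu _ IHv||g h|b|a Aa]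
  p redp.
- exact: hnn_form_eq_refl.
- by apply: hnn_form_eq_sym; apply: IHuv.
- exact: hnn_form_eq_trans (IHuv _ redp) (IHvw _ redp).
- rewrite /hnn_acts !foldr_cat.
  apply: hnn_form_eq_trans (IHu _ (reduced_acts _ redp)) _.
  by apply: hnn_acts_eq; apply: IHv.
- by case: p redp => h s _ /=; rewrite mul1g; apply: hnn_form_eq_refl.
- by rewrite /= mulgA; apply: hnn_form_eq_refl.
(* The relation [t^b t^-b = 1] is the conjugation relation for the element 1. *)
- have := hnn_acts_conj (assoc1 b) redp.
  rewrite assoc_iso1 -[hnn_acts _ p]/(hnn_act (inr b)
    (1 * (hnn_act (inr (~~ b)) p).1, (hnn_act (inr (~~ b)) p).2)).
  by rewrite !mul1g -!surjective_pairing.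
- exact: (@hnn_acts_conj true).
Qed.

(** * Forms as elements of the HNN extension *)

Local Notation base := (hnn_base A phi).
Local Notation class := (hnn_class A phi).

Lemma hnn_class_cat u v : class (u ++ v) = class u * class v.
Proof. by rewrite -hnn_mulgE. Qed.

Lemma hnn_class_cons l u : class (l :: u) = class [:: l] * class u.
Proof. exact: (hnn_class_cat [:: l]). Qed.

Lemma hnn_base1 : base 1 = 1.
Proof. by apply/hnn_classP; apply: hnn_one. Qed.

Lemma hnn_classVt e : class [:: inr e] * class [:: inr (~~ e)] = 1.
Proof. by rewrite -hnn_class_cat; apply/hnn_classP; apply: hnn_tVt. Qed.

Lemma hnn_baseV g : (base g)^-1 = base g^-1.
Proof. by apply: (mulIg (base g)); rewrite -hnn_baseM !mulVg hnn_base1. Qed.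

Lemma hnn_stableV : (hnn_stable A phi)^-1 = class [:: inr true].
Proof.
by apply: (mulIg (hnn_stable A phi)); rewrite mulVg (hnn_classVt true).
Qed.

Lemma hnn_class_pinch e a : assoc e a ->
  class [:: inr e] * base a * class [:: inr (~~ e)] = base (assoc_iso e a).
Proof.
have conj b : A b ->
    class [:: inr true] * base b * class [:: inr false] = base (phi b).
  move=> Ab; rewrite -(hnn_class_cat [:: inr true] [:: inl b]).
  rewrite -(hnn_class_cat [:: inr true; inl b] [:: inr false]).
  by apply/hnn_classP; apply: hnn_conj.
case: e => /= [/conj //|Ba].
(* For [e = false], [a = phi (psi a)] is replaced by [t^-1 (psi a) t], and the outer stable letters
   cancel. *)
rewrite -[a in LHS](psiK (mem_set Ba)) -conj; last exact: psi_fun.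
rewrite !mulgA (hnn_classVt false) mul1g -mulgA (hnn_classVt false) mulg1 //.
Qed.

Definition form_word (p : hnn_form) : seq (hnn_letter G) :=
  inl p.1 :: flatten [seq [:: inr x.1; inl x.2] | x <- p.2].

Lemma form_word_cons h e g s :
  class (form_word (h, (e, g) :: s)) =
  base h * (class [:: inr e] * class (form_word (g, s))).
Proof. by rewrite /form_word /= hnn_class_cons [X in _ * X]hnn_class_cons. Qed.

Lemma form_word_mul g p :
  class (form_word (g * p.1, p.2)) = base g * class (form_word p).
Proof.
rewrite /form_word /= hnn_class_cons [class (inl p.1 :: _)]hnn_class_cons.
by rewrite mulgA -hnn_baseM.
Qed.

(** Cancelling a pinch is a valid identity in the extension, so the action realizes left
    multiplication there. *)
Lemma form_word_act l p :
  class (form_word (hnn_act l p)) = class [:: l] * class (form_word p).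
Proof.
case: l => [g|e]; first exact: form_word_mul.
have push : class (form_word (1, (e, p.1) :: p.2)) =
    class [:: inr e] * class (form_word p).
  by rewrite form_word_cons hnn_base1 mul1g -surjective_pairing.
case: p push => h [|[e' g] s] //=.
case: eqVneq => [->|//]; case: asboolP => [Dh|//] _.
by rewrite (form_word_mul _ (g, s)) form_word_cons -hnn_class_pinch // !mulgA.
Qed.

Lemma form_word_acts u p :
  class (form_word (hnn_acts u p)) = class u * class (form_word p).
Proof.
elim: u => [|l u IHu] /=; first by rewrite [class [::]](_ : _ = 1) // mul1g.
by rewrite form_word_act IHu mulgA -hnn_class_cons.
Qed.

(** * Forms with entries in a submonoid of the base group *)

Definition form_in (N : set G) (p : hnn_form) : bool :=
  all (fun g => `[< N g >]) (p.1 :: unzip2 p.2).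

Section FormIn.
Variable N : set G.
Hypotheses (N1 : N 1) (NM : forall g h, N g -> N h -> N (g * h)).
Hypothesis assocN : forall e, assoc e `<=` N.

(** In [g' = a^-1 g (g^-1 a g')] the last factor is in [N] by induction. The only inverse that must
    lie in [N] is that of an element of [assoc e], so a monoid suffices. *)
Lemma hnn_tail_eq_in c s s' : hnn_tail_eq c s s' ->
  all (fun g => `[< N g >]) (unzip2 s) ->
  N c /\ all (fun g => `[< N g >]) (unzip2 s').
Proof.
elim: s s' c => [|[e g] s IHs] [|[e' g'] s'] c //= => [-> //|].
case=> _ [a Da [-> ss']] /andP[/asboolP Ng Ns]; have [Nc Ns'] := IHs _ _ ss' Ns.
split; first by apply: assocN (assoc_isoP Da).
rewrite Ns' andbT; apply/asboolP.
have -> : g' = a^-1 * (g * (g^-1 * a * g')) by rewrite -mulgA mulVKg mulKg.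
by apply: NM; [apply: assocN (assocV Da) | apply: NM].
Qed.

Lemma form_in_eq p q : hnn_form_eq p q -> form_in N p -> form_in N q.
Proof.
move=> pq /andP[/asboolP Np1 Np2]; have [Nc Nq] := hnn_tail_eq_in pq Np2.
apply/andP; split=> //; apply/asboolP.
by rewrite -[q.1](mulVKg p.1); apply: NM.
Qed.

Definition letter_in (l : hnn_letter G) : bool :=
  if l is inl g then `[< N g >] else true.

Lemma form_in_act l p : letter_in l -> form_in N p -> form_in N (hnn_act l p).
Proof.
case: l => [g|e] /=.
  move=> /asboolP Ng /andP[/asboolP Np ?]; apply/andP; split=> //.
  by apply/asboolP; apply: NM.
move=> _; have T1 : `[< N 1 >] by apply/asboolP.
case: p => h [|[e' g] s]; rewrite /form_in /=; first by rewrite T1.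
move=> /and3P[Nh Ng Ns].
case: ifP => [/andP[_ /asboolP Dh]|_] /=; last by rewrite T1 Nh Ng.
rewrite Ns andbT; apply/asboolP; apply: NM; last exact/asboolP.
exact: assocN (assoc_isoP Dh).
Qed.

Lemma form_in_acts u : all letter_in u -> form_in N (hnn_acts u (1, [::])).
Proof.
elim: u => [_|l u IHu /= /andP[Nl /IHu]]; last exact: form_in_act.
by rewrite /form_in /= andbT; apply/asboolP.
Qed.

End FormIn.

(** An element of [M] has some word over [N] and the stable letters; the form of that word has
    entries in [N], and so has the form of any congruent [u]. Conversely, [class u] is the product
    read off its form, whose factors are in [M]. *)
Lemma hnn_submonoidP (M : set (hnn A phi)) :
  is_submonoid M ->
  base @` (A `|` B) `<=` M ->
  M = submonoid_gen ((M `&` range base)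
        `|` [set hnn_stable A phi; (hnn_stable A phi)^-1]) ->
  forall u, M (class u) <-> form_in (base @^-1` M) (hnn_acts u (1, [::])).
Proof.
move=> [/set_mem M1 Mmul] ABM M_gen u; pose N := base @^-1` M.
have MM x y : M x -> M y -> M (x * y).
  by move=> /mem_set Mx /mem_set My; apply: set_mem; apply: Mmul.
have N1 : N 1 by rewrite /N /= hnn_base1.
have NM g h : N g -> N h -> N (g * h) by rewrite /N /= hnn_baseM; apply: MM.
have assocN e : assoc e `<=` N.
  by case: e => g Dg; apply: ABM; exists g => //; [left|right].
have Mt e : M (class [:: inr e]).
  rewrite M_gen; apply: sub_gen_smallest; right.
  by case: e; [right; rewrite -hnn_stableV | left].
split=> [|/=].
  (* The classes of words over [N] and the stable letters form a submonoid that contains the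
     generators of [M]. *)
  have: M `<=` [set m | exists2 v, all (letter_in N) v & class v = m].
    rewrite {1}M_gen; apply: smallest_sub.
      split=> [|x y]; first by apply/mem_set; exists [::].
      move=> /set_mem[v Nv <-] /set_mem[w Nw <-]; apply/mem_set.
      by exists (v ++ w); rewrite ?all_cat ?Nv ?hnn_class_cat.
    move=> m [[Mm [g _ gm]]|].
      exists [:: inl g] => //=.
      by rewrite andbT; apply/asboolP; rewrite /N /= gm.
    case=> ->; first by exists [:: inr false].
    by exists [:: inr true]; rewrite ?hnn_stableV.
  move=> /[apply] -[v Nv /hnn_classP vu].
  apply: form_in_eq (form_in_acts N1 NM assocN Nv) => //.
  exact: hnn_cong_acts.
have := form_word_acts u (1, [::]).
rewrite [class (form_word (1, _))]hnn_base1 mulg1 => <-.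
case: (hnn_acts _ _) => h s; elim: s h => [|[e g] s IHs] h.
  by rewrite /form_in /= andbT => /asboolP.
move=> /andP[/asboolP Nh Ns]; rewrite form_word_cons.
by exact: MM Nh (MM _ _ (Mt e) (IHs _ Ns)).
Qed.

End Britton.

(** * Words as sequences of natural numbers *)

Definition letter_nat n (l : 'I_n * bool) : nat := ((val l.1).*2 + l.2)%N.

Lemma word_code_encode n (w : word n) :
  word_code w = encode (map (@letter_nat n) w).
Proof. by rewrite encode_seq_nat. Qed.

Lemma letter_nat_lt n (l : 'I_n * bool) : (letter_nat l < n.*2)%N.
Proof.
case: l => i b; rewrite /letter_nat /=; apply: (@leq_trans (i.+1).*2).
  by rewrite doubleS ltnS -addn1 leq_add2l leq_b1.
by rewrite leq_double.
Qed.

Lemma odd_letter_nat n (l : 'I_n * bool) : odd (letter_nat l) = l.2.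
Proof. by rewrite /letter_nat oddD odd_double oddb. Qed.

Lemma half_letter_nat n (l : 'I_n * bool) : (letter_nat l)./2 = l.1.
Proof. by rewrite /letter_nat addnC half_bit_double. Qed.

Section NatWords.
Variables (G : groupType) (n : nat) (x : 'I_n -> G).

(* Letters outside the alphabet stand for 1. *)
Definition letter_value (l : nat) : G :=
  if insub l./2 is Some i then if odd l then (x i)^-1 else x i else 1.

Definition nat_word_value (s : seq nat) : G := \prod_(l <- s) letter_value l.

Lemma letter_value_nat (l : 'I_n * bool) :
  letter_value (letter_nat l) = if l.2 then (x l.1)^-1 else x l.1.
Proof. by rewrite /letter_value half_letter_nat valK odd_letter_nat. Qed.

Lemma nat_word_value_word (w : word n) :
  nat_word_value (map (@letter_nat n) w) = word_value x w.
Proof.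
rewrite /nat_word_value big_map; apply: eq_bigr => l _.
exact: letter_value_nat.
Qed.

Lemma nat_word_value_cat s r :
  nat_word_value (s ++ r) = nat_word_value s * nat_word_value r.
Proof. exact: big_cat. Qed.

Lemma nat_word_value_cons l s :
  nat_word_value (l :: s) = letter_value l * nat_word_value s.
Proof. exact: big_cons. Qed.

(** Deciders are specified only on codes of genuine words. Dropping all numbers from [n.*2] on
    yields such a word and keeps the value, as those letters stand for 1. *)
Lemma filter_nat_word s : exists2 w : word n,
  map (@letter_nat n) w = [seq l <- s | l < n.*2]%N &
  word_value x w = nat_word_value s.
Proof.
elim: s => [|l s [w wE wv]].
  by exists [::] => //; rewrite -nat_word_value_word.
rewrite nat_word_value_cons /=; case: ltnP => ln; last first.
  exists w => //; rewrite /letter_value insubN ?mul1g //.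
  by rewrite -leqNgt -[n]doubleK half_leq.
have l2n : (l./2 < n)%N.
  rewrite -ltn_double (leq_ltn_trans _ ln) //.
  by rewrite -{2}[l]odd_double_half leq_addl.
have lE : letter_nat (Ordinal l2n, odd l) = l.
  by rewrite /letter_nat /= addnC odd_double_half.
exists ((Ordinal l2n, odd l) :: w); first by rewrite /= lE wE.
rewrite -nat_word_value_word /= nat_word_value_cons lE.
by rewrite nat_word_value_word wv.
Qed.

Lemma decidable_computable (N : set G) : decidable_membership x N ->
  computable (fun s => `[< N (nat_word_value s) >]).
Proof.
move=> [d rd dE].
have cd : computable (fun s : seq nat =>
    `[< N (nat_word_value [seq l <- s | l < n.*2]%N) >]).
  have cf : computable (fun s : seq nat => [seq l <- s | l < n.*2]%N).
    apply: (computable_filter 0%N); last exact: computable_id.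
    exact/computable_ltn/computable_id.
  have [F rF FE] := cf.
  exists (fun c => d [tuple F c]).
    by have := recursive_comp rd (fun=> rF); apply: recursive_ext => v;
      rewrite [mktuple _]tuple1_eta /thead tnth_mktuple.
  move=> s; rewrite FE; have [w <- _] := filter_nat_word s.
  by rewrite -word_code_encode dE nat_word_value_word.
apply: computable_ext cd => s; have [w wE <-] := filter_nat_word s.
by rewrite -wE nat_word_value_word.
Qed.

Lemma nat_word_value_surj (x_gen : subgroup_gen (range x) = setT) g :
  exists s, nat_word_value s = g.
Proof.
have: (subgroup_gen (range x)) g by rewrite x_gen.
suff: subgroup_gen (range x) `<=` range nat_word_value.
  by move=> /[apply] -[s _ <-]; exists s.
apply: smallest_sub => [|_ [i _ <-]]; last first.
  exists [:: letter_nat (i, false)] => //.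
  by rewrite nat_word_value_cons letter_value_nat /nat_word_value big_nil mulg1.
split=> [|_ _ /set_mem[s _ <-] /set_mem[r _ <-]]; apply/mem_set.
  by exists [::] => //; rewrite /nat_word_value big_nil.
suff [r' <-] : exists r', nat_word_value r' = (nat_word_value r)^-1.
  by exists (s ++ r') => //; rewrite nat_word_value_cat.
have [w _ <-] := filter_nat_word r.
exists (map (@letter_nat n) (rev [seq (l.1, ~~ l.2) | l <- w])).
rewrite nat_word_value_word /word_value.
elim: w => [|l w IHw]; first by rewrite !big_nil invg1.
rewrite /= rev_cons -cats1 big_cat big_seq1 big_cons invgM -IHw /=.
by case: l.2; rewrite ?invgK.
Qed.

(** * Computing the isomorphisms between the associated subgroups *)

(** [gs] lists the generators and their inverses, and indices past its end denote 1. Hence every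
    sequence of numbers describes an element of [D], and a search may run over all of them. *)
Lemma subgroup_gen_words (D : set G) : fg_subgroup D ->
  exists2 gs : seq G, (forall j, D (nth 1 gs j)) &
    forall g, D g -> exists m, \prod_(j <- m) nth 1 gs j = g.
Proof.
move=> [S /finite_seqP[r ->] ->].
have [D1 DV] : is_subgroup (subgroup_gen [set` r]).
  split=> [|g h /set_mem Dg /set_mem Dh]; apply/mem_set => E [/= [E1 EV] rE].
    exact: set_mem.
  by apply: (set_mem (EV _ _ (mem_set (Dg E _)) (mem_set (Dh E _)))); split.
have rD g : g \in r -> g \in subgroup_gen [set` r].
  by move=> rg; apply/mem_set; apply: sub_gen_smallest.
exists (r ++ [seq g^-1 | g <- r]) => [j|].
  apply/set_mem; have [jlt|jge] := ltnP j (size (r ++ [seq g^-1 | g <- r]));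
    last by rewrite nth_default.
  have := mem_nth 1 jlt; rewrite mem_cat => /orP[/rD //|/mapP[g rg ->]].
  by rewrite -[_^-1]mul1g; apply: DV => //; apply: rD.
set gs := r ++ _.
suff: subgroup_gen [set` r] `<=` range (fun m => \prod_(j <- m) nth 1 gs j).
  by move=> sub g /sub[m _ <-]; exists m.
have inP g : g \in gs -> exists j, nth 1 gs j = g.
  by move=> gg; exists (index g gs); apply: nth_index.
apply: smallest_sub => [|g /= rg]; last first.
  have /inP[j jE] : g \in gs by rewrite mem_cat rg.
  by exists [:: j] => //; rewrite big_cons big_nil mulg1.
split=> [|_ _ /set_mem[s _ <-] /set_mem[m _ <-]]; apply/mem_set.
  by exists [::] => //; rewrite big_nil.
suff [m' <-] : exists m',
    \prod_(j <- m') nth 1 gs j = (\prod_(j <- m) nth 1 gs j)^-1.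
  by exists (s ++ m') => //; rewrite big_cat.
elim: m => [|j m [m' IHm]]; first by exists [::]; rewrite !big_nil invg1.
have [j' j'E] : exists j', nth 1 gs j' = (nth 1 gs j)^-1.
  have [jlt|jge] := ltnP j (size gs); last first.
    by exists j; rewrite nth_default // invg1.
  apply: inP; have := mem_nth 1 jlt; rewrite !mem_cat => /orP[gr|/mapP[g gr ->]].
    by rewrite map_f // orbT.
  by rewrite invgK gr.
exists (m' ++ [:: j']).
by rewrite big_cat big_seq1 big_cons invgM IHm j'E.
Qed.

Lemma computable_morph (D : set G) (f : G -> G) :
  subgroup_gen (range x) = setT -> decidable_word_problem x ->
  is_subgroup D -> fg_subgroup D -> decidable_membership x D ->
  {in D &, {morph f : g h / g * h}} ->
  exists2 F : seq nat -> seq nat, computable F &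
    forall s, D (nat_word_value s) ->
      nat_word_value (F s) = f (nat_word_value s).
Proof.
move=> /nat_word_value_surj surj /decidable_computable c1 Dsub.
move=> /subgroup_gen_words[gs Dgs gsP].
move=> /decidable_computable cD fM.
(* [wd] is not computable in general, but only its finitely many values in [us] and [vs] enter the
   algorithm. *)
have [wd wdK] := choice surj.
have f1 : f 1 = 1.
  by apply: (mulgI (f 1)); rewrite -fM ?mulg1 // (proj1 Dsub).
have DM g h : D g -> D h -> D (g * h).
  move=> /mem_set Dg /mem_set Dh; apply: set_mem; exact: (group_closedM Dsub).
pose us := map wd gs; pose vs := map (fun g => wd (f g)^-1) gs.
have usE j : nat_word_value (nth [::] us j) = nth 1 gs j.
  have [jlt|jge] := ltnP j (size gs); first by rewrite (nth_map 1) // wdK.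
  by rewrite !nth_default ?size_map // /nat_word_value big_nil.
have vsE j : nat_word_value (nth [::] vs j) = (f (nth 1 gs j))^-1.
  have [jlt|jge] := ltnP j (size gs); first by rewrite (nth_map 1) // wdK.
  by rewrite !nth_default ?size_map // f1 invg1 /nat_word_value big_nil.
pose su (m : seq nat) := foldr (fun j r => nth [::] us j ++ r) [::] m.
have suE m : nat_word_value (su m) = \prod_(j <- m) nth 1 gs j.
  elim: m => [|j m IHm]; first by rewrite /nat_word_value !big_nil.
  by rewrite /= nat_word_value_cat usE IHm big_cons.
(* The left fold reverses the order of the factors, as the inverse of a product requires. *)
pose sv (m : seq nat) := foldl (fun r j => nth [::] vs j ++ r) [::] m.
have Dprod m : D (\prod_(j <- m) nth 1 gs j).
  elim: m => [|k m IHm]; rewrite (big_nil, big_cons); last exact: DM.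
  exact: (set_mem (proj1 Dsub)).
have svE m : nat_word_value (sv m) = (f (\prod_(j <- m) nth 1 gs j))^-1.
  suff svE r : nat_word_value (foldl (fun r j => nth [::] vs j ++ r) r m) =
      (f (\prod_(j <- m) nth 1 gs j))^-1 * nat_word_value r.
    by rewrite svE /nat_word_value big_nil mulg1.
  elim: m r => [|j m IHm] r /=; first by rewrite big_nil f1 invg1 mul1g.
  by rewrite IHm nat_word_value_cat vsE big_cons mulgA -invgM fM ?mem_set.
(* The search is for an expression of the inverse, so that its correctness is an
   instance of the word problem without having to invert words. *)
pose p (q : seq nat * seq nat) := if `[< D (nat_word_value q.1) >] then
  `[< [set 1] (nat_word_value (q.1 ++ su q.2)) >] else true.
have cfst : computable (fun q : seq nat * seq nat => q.1).
  by computable_projection.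
have csu (X : Type) (cX : encodable X) (g : X -> seq nat) :
    computable g -> computable (fun y => su (g y)).
  move=> cg; pose h (q : X * nat * seq nat) := nth [::] us q.1.2 ++ q.2.
  apply: (computable_foldr 0%N (h := h)) cg; last exact: computable_const.
  by apply: (computable_cat 0%N); [apply: computable_nth|]; computable_projection.
have csv : computable sv.
  pose h (q : seq nat * seq nat * nat) := nth [::] vs q.2 ++ q.1.2.
  apply: (computable_foldl 0%N (h := h)).
  - by apply: (computable_cat 0%N); [apply: computable_nth|]; computable_projection.
  - exact: computable_const.
  - exact: computable_id.
have cp : computable p.
  apply: computable_if; last exact: computable_const.
    exact: (computable_comp cD).
  apply: (computable_comp c1); apply: (computable_cat 0%N) => //.
  by apply: csu; computable_projection.
have decK : cancel CodeSeq.decode (encode : seq nat -> nat).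
  by move=> c; rewrite encode_seq_nat CodeSeq.decodeK.
have codK : cancel (encode : seq nat -> nat) CodeSeq.decode.
  by move=> c; rewrite encode_seq_nat CodeSeq.codeK.
have [|F cF FP] := computable_search decK decK codK cp.
  (* Outside [D] the test always succeeds, which makes the search total. *)
  move=> s; rewrite /p /=; case: asboolP => [Ds|_]; last by exists [::].
  have [m mE] : exists m, \prod_(j <- m) nth 1 gs j = (nat_word_value s)^-1.
    by apply: gsP; apply: set_mem; apply: (group_closedV Dsub); apply: mem_set.
  by exists m; apply/asboolP; rewrite /= nat_word_value_cat suE mE mulgV.
exists (fun s => sv (F s)); first exact: computable_comp.
move=> s Ds; rewrite svE -suE; have := FP s.
rewrite /p /= asboolT // => /asboolP /=; rewrite nat_word_value_cat => sF.
have Dsu : D (nat_word_value (su (F s))). by rewrite suE.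
apply: (mulIg (f (nat_word_value (su (F s))))).
by rewrite mulVg -fM ?mem_set // sF f1.
Qed.

End NatWords.

(** * Words over the generators of the HNN extension *)

Section NatLetters.
Variables (G : groupType) (n : nat) (x : 'I_n -> G).
Variables (A : set G) (phi : G -> G).

(** The stable letter has index [n], so it and its inverse have the numbers [n.*2] and [n.*2.+1];
    parity gives the sign. *)
Definition nat_letter_hnn (l : nat) : hnn_letter G :=
  if (l < n.*2)%N then inl (letter_value x l) else inr (odd l).

Lemma word_value_hnn (w : word n.+1) :
  word_value (hnn_gen A phi x) w =
  hnn_class A phi [seq nat_letter_hnn l | l <- map (@letter_nat n.+1) w].
Proof.
rewrite /word_value; elim: w => [|[i b] w IHw]; first by rewrite big_nil.
rewrite big_cons IHw /= [RHS]hnn_class_cons; congr (_ * _).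
rewrite /hnn_gen /nat_letter_hnn; case: unliftP => [j ->|->].
  (* Lifting past the last index shifts nothing: generators of [G] keep their numbers. *)
  have -> : letter_nat (lift ord_max j, b) = letter_nat (j, b).
    by rewrite /letter_nat /= /bump leqNgt ltn_ord.
  rewrite letter_nat_lt letter_value_nat /=.
  by case: b => //; rewrite hnn_baseV.
rewrite odd_letter_nat ltnNge {1}/letter_nat /= leq_addr /=.
by case: b => //; rewrite hnn_stableV.
Qed.

End NatLetters.

(** * Computing the action on forms given by words *)

Section Evaluation.
Variables (G : groupType) (n : nat) (x : 'I_n -> G).
Variables (A B : set G) (phi psi : G -> G).
Variables (dA dB : seq nat -> bool) (wphi wpsi : seq nat -> seq nat).
Hypotheses (dAE : forall s, dA s = `[< A (nat_word_value x s) >])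
  (dBE : forall s, dB s = `[< B (nat_word_value x s) >]).
Hypothesis wphiE : forall s, A (nat_word_value x s) ->
  nat_word_value x (wphi s) = phi (nat_word_value x s).
Hypothesis wpsiE : forall s, B (nat_word_value x s) ->
  nat_word_value x (wpsi s) = psi (nat_word_value x s).

Definition nat_form : Type := (seq nat * seq (bool * seq nat))%type.

Definition form_value (p : nat_form) : hnn_form G :=
  (nat_word_value x p.1, [seq (c.1, nat_word_value x c.2) | c <- p.2]).

(** [hnn_act] with words for group elements, written with [head] and [behead] to suit the
    computability lemmas. The [nilp] test keeps the default of [head] from mattering. *)
Definition nat_step (l : nat) (p : nat_form) : nat_form :=
  if (l < n.*2)%N then (l :: p.1, p.2)
  else if [&& ~~ nilp p.2,
              (if odd l then ~~ (head (false, [::]) p.2).1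
               else (head (false, [::]) p.2).1)
            & if odd l then dA p.1 else dB p.1]
  then ((if odd l then wphi p.1 else wpsi p.1) ++ (head (false, [::]) p.2).2,
        behead p.2)
  else ([::], (odd l, p.1) :: p.2).

Lemma form_value_step l p :
  form_value (nat_step l p) =
  hnn_act A B phi psi (nat_letter_hnn x l) (form_value p).
Proof.
rewrite /nat_step /nat_letter_hnn /form_value.
case: ifP => _; first by rewrite /= nat_word_value_cons.
case: p => h [|[e s] r]; first by rewrite /= /nat_word_value big_nil.
have -> : [&& ~~ nilp ((e, s) :: r), if odd l then ~~ e else e
    & if odd l then dA h else dB h] =
  (e == ~~ odd l) && `[< assoc A B (odd l) (nat_word_value x h) >].
  by rewrite /= /assoc; case: (odd l); rewrite ?dAE ?dBE; case: e.
rewrite /=; case: ifP => [/andP[_ /asboolP Dh]|_] /=; last first.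
  by rewrite {1}/nat_word_value big_nil.
rewrite nat_word_value_cat; congr (_ * _, _).
move: Dh; rewrite /assoc /assoc_iso.
by case: (odd l); [apply: wphiE | apply: wpsiE].
Qed.

Lemma form_value_foldr s :
  form_value (foldr nat_step ([::], [::]) s) =
  hnn_acts A B phi psi [seq nat_letter_hnn x l | l <- s] (1, [::]).
Proof.
elim: s => [|l s IHs]; last by rewrite /= form_value_step IHs.
by rewrite /form_value /= /nat_word_value big_nil.
Qed.

Hypotheses (cdA : computable dA) (cdB : computable dB).
Hypotheses (cwphi : computable wphi) (cwpsi : computable wpsi).

Lemma computable_step : computable (fun q : nat * nat_form => nat_step q.1 q.2).
Proof.
have cl : computable (fun q : nat * nat_form => q.1) by computable_projection.
have ch : computable (fun q : nat * nat_form => q.2.1) by computable_projection.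
have cr : computable (fun q : nat * nat_form => q.2.2) by computable_projection.
have co := computable_odd cl.
have chd := computable_head (false, [::]) cr.
have che := computable_fst chd.
apply: computable_if; first exact: computable_ltn.
  by apply: computable_pair => //; apply: computable_cons.
apply: computable_if.
- apply: computable_and; first by apply: computable_not; apply: computable_nilp.
  apply: computable_and; apply: computable_if => //; first exact: computable_not.
    exact: (computable_comp cdA).
  exact: (computable_comp cdB).
- apply: computable_pair; last exact: computable_behead.
  apply: (computable_cat 0%N); last exact: computable_snd.
  apply: computable_if => //; first exact: (computable_comp cwphi).
  exact: (computable_comp cwpsi).
- apply: computable_pair; first exact: computable_const.
  by apply: computable_cons => //; apply: computable_pair.
Qed.

Lemma computable_form_in (N : set G) : decidable_membership x N ->
  computable (fun s => form_in N
    (hnn_acts A B phi psi [seq nat_letter_hnn x l | l <- s] (1, [::]))).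
Proof.
move=> /decidable_computable cN.
pose eval s := foldr nat_step ([::], [::]) s.
have ceval : computable eval.
  have ch : computable (fun q : seq nat * nat * nat_form => nat_step q.1.2 q.2).
    apply: (computable_comp computable_step (f := fun q => (q.1.2, q.2))).
    by apply: computable_pair; computable_projection.
  apply: (computable_foldr 0%N ch); last exact: computable_id.
  exact: (computable_const ([::], [::])).
have cin : computable (fun s => all (fun h => `[< N (nat_word_value x h) >])
    ((eval s).1 :: unzip2 (eval s).2)).
  apply: (computable_all [::]) => //.
  apply: computable_cons; first exact: computable_fst.
  apply: (computable_map (false, [::])); first by computable_projection.
  exact: computable_snd.
apply: computable_ext cin => s.
rewrite -form_value_foldr -/(eval s) /form_in /form_value /=; congr (_ && _).
by elim: (eval s).2 => //= c r ->.
Qed.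

End Evaluation.

(** * Assembling the decision procedure *)

Theorem theoremC (G : groupType) (n : nat) (x : 'I_n -> G)
  (x_gen : subgroup_gen (range x) = setT)
  (A B : set G) (phi : G -> G)
  (A_subgroup : is_subgroup A) (B_subgroup : is_subgroup B)
  (phi_morph : {in A &, {morph phi : a b / a * b}})
  (phi_bij : set_bij A B phi)
  (A_fg : fg_subgroup A) (B_fg : fg_subgroup B)
  (G_word : decidable_word_problem x)
  (A_mem : decidable_membership x A) (B_mem : decidable_membership x B)
  (M : set (hnn A phi)) (M_submonoid : is_submonoid M)
  (AB_sub_M : hnn_base A phi @` (A `|` B) `<=` M)
  (MG_fg : fg_submonoid (hnn_base A phi @^-1` M))
  (M_gen : M = submonoid_gen
     ((M `&` range (hnn_base A phi))
        `|` [set hnn_stable A phi; (hnn_stable A phi)^-1]))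
  (MG_mem : decidable_membership x (hnn_base A phi @^-1` M)) :
  decidable_membership (hnn_gen A phi x) M.
Proof.
have [phi_fun phi_inj phi_surj] := phi_bij.
(* The inverse of [phi] as a total function; off [B] its values are arbitrary. *)
have [psi psiP] :
    {psi : G -> G & forall b, B b -> A (psi b) /\ phi (psi b) = b}.
  apply: (choice (P := fun b a => B b -> A a /\ phi a = b)) => b.
  have [/phi_surj[a Aa <-]|nBb] := pselect (B b); first by exists a.
  by exists b.
have psi_fun : set_fun B A psi by move=> b /psiP[].
have psiK : {in B, cancel psi phi} by move=> b /set_mem/psiP[].
have phiK : {in A, cancel phi psi}.
  move=> a Aa; have [Ab] := psiP _ (phi_fun _ (set_mem Aa)).
  by apply: phi_inj => //; apply: mem_set.
have psi_morph : {in B &, {morph psi : a b / a * b}}.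
  move=> a b /set_mem Ba /set_mem Bb.
  exact: (assoc_isoM A_subgroup B_subgroup phi_morph psi_fun phiK psiK
    (e := false)).
have [wphi cwphi wphiE] :=
  computable_morph x_gen G_word A_subgroup A_fg A_mem phi_morph.
have [wpsi cwpsi wpsiE] :=
  computable_morph x_gen G_word B_subgroup B_fg B_mem psi_morph.
(* The tests for [A] and [B] are the membership predicates themselves, so their specifications hold
   by reflexivity. *)
have [F rF FE] := computable_form_in (fun=> erefl) (fun=> erefl) wphiE wpsiE
  (decidable_computable A_mem) (decidable_computable B_mem) cwphi cwpsi MG_mem.
exists (fun v => F (thead v)) => // w.
rewrite /thead tnth0 word_code_encode FE word_value_hnn.
congr nat_of_bool; apply/idP/asboolP;
by apply hnn_submonoidP.
Qed.
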